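(* Let $q=p^k$ be a prime power ($p$ prime, $k\ge1$). Suppose $b:\mathbb{Z}_{\geq 0}\to\mathbb{Z}$ satisfies (1) $b(0)\equiv 1\pmod q$; (2) $q^2\mid (\Delta b)(x)$ for all $x\in\mathbb{Z}_{\geq0}$; (3) $q^n\mid(\Delta^n b)(x)$ for all integers $n\ge 2$ and all $x\in\mathbb{Z}_{\geq0}$. Then for every nonnegative integer $n$, \[C_n^{(q)}(b)\equiv C_n^{(q)}\pmod{p^{\xi+k}},\qquad\text{where }\ \xi=\frac{s_p((q-1)n+1)-1}{p-1}=\xi_p\big(C_n^{(q)}\big).\]
   Context: For $f:\mathbb{Z}_{\geq0}\to\mathbb{Z}$, $(\Delta f)(x)=f(x+1)-f(x)$ and $\Delta^n$ is its $n$-fold iterate. $C_n^{(q)}=\frac{1}{(q-1)n+1}\binom{qn}{n}$. A $q$-ary tree is a rooted tree in which every vertex has $q$ distinguishable child positions (numbered $1,\dots,q$), each either empty or occupied by a child; $C_n^{(q)}$ is the number of $q$-ary trees with $n$ vertices. Call an edge a right edge if it goes from a vertex to its child in position $q$, and a non-right edge otherwise. For a $q$-ary tree $T$, give each vertex $v$ the weight $b(i_v)$, where $i_v$ is the number of non-right edges on the path from the root to $v$, and let $\mathrm{wt}(T)$ be the product of the weights of its vertices. The weighted $q$-Catalan number is $C_n^{(q)}(b)=\sum_T \mathrm{wt}(T)$, summed over all $q$-ary trees with $n$ vertices. For a nonzero integer $N$, $\xi_p(N)$ is the exponent of the largest power of $p$ dividing $N$, and $s_p(N)$ is the sum of the base-$p$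 digits of $N$. *)

(* Defs.v *)
From HB Require Import structures.
From mathcomp Require Import all_boot all_order all_algebra.

Set Implicit Arguments.
Unset Strict Implicit.
Unset Printing Implicit Defensive.

Import Order.TTheory GRing.Theory Num.Theory.
Local Open Scope ring_scope.

Definition fdiff (f : nat -> int) : nat -> int := fun x => f x.+1 - f x.

Definition qcatalan (q n : nat) : nat := ('C(q * n, n) %/ (q.-1 * n).+1)%N.

(* The truncating division in [qcatalan] is exact. *)
Lemma qcatalanE (q n : nat) : (0 < q)%N ->
  ((q.-1 * n).+1 * qcatalan q n = 'C(q * n, n))%N.
Proof.
case: q => // q _; case: n => [|n]; first by rewrite /qcatalan !muln0 bin0 divn1.
rewrite /qcatalan /= mulnC divnK //.
have co : coprime (q * n.+1).+1 n.+1.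
  by rewrite -[(q * _).+1]addn1 coprime_sym /coprime gcdnMDl gcdn1.
rewrite -(Gauss_dvdl _ co) [X in (_ %| X)%N]mulnC mul_bin_left.
suff -> : (q.+1 * n.+1 - n = (q * n.+1).+1)%N by rewrite dvdn_mulr.
by rewrite mulSn addnC -addnBA ?leqnSn // subSnn addn1.
Qed.

(* For [1 < p] the digits of [N] of index at least [N] vanish, as [N < p ^ N]. *)
Definition digit_sum (p N : nat) : nat := (\sum_(i < N) (N %/ p ^ i) %% p)%N.

(* [qtree q h] is the finite type of the q-ary trees with at most [h] levels of
   vertices. A tree is either empty ([tt], [None]) or a root together with the
   q subtrees (possibly empty) at its child positions. *)
Fixpoint qtree (q h : nat) : finType :=
  if h is h'.+1 then (option {ffun 'I_q -> qtree q h'} : finType)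
  else (unit : finType).

(* A vertex is identified with the path from the root to it, that is, with the
   sequence of the child positions of its successive edges. *)
Fixpoint vertices (q h : nat) : qtree q h -> seq (seq 'I_q) :=
  if h is h'.+1 return qtree q h -> seq (seq 'I_q)
  then fun T => if T is Some f
                then [::] :: [seq i :: v | i <- enum 'I_q, v <- vertices (f i)]
                else [::]
  else fun=> [::].

(* The positions 1, ..., q are numbered 0, ..., q - 1 in ['I_q]. *)
Definition non_right (q : nat) (i : 'I_q) : bool := i.+1 != q.

Definition wt (b : nat -> int) (q h : nat) (T : qtree q h) : int :=
  \prod_(v <- vertices T) b (count (@non_right q) v).

(* A tree with [n] vertices has at most [n] levels, so every q-ary tree with [n]
   vertices occurs exactly once in [qtree q n]. *)
Definition wqcatalan (b : nat -> int) (q n : nat) : int :=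
  \sum_(T : qtree q n | size (vertices T) == n) wt b T.

(* Main.v *)
(** Let g_x be the sum over q-ary trees T of wt_x(T) u^L / q!^n, where T has n
    vertices and L = (q-1)n + 1 leaves, and wt_x is the weight for b(x + .); then
    g_x = u + b(x) g_x g_(x+1)^(q-1) / q!.  As v_p(q!) = (q-1)/(p-1), Legendre's
    formula turns divisibility of C_n(b) by p^xi into p-integrality of the
    coefficients of g_x with respect to the divided powers u^L / L!, and the
    congruence into one modulo q.  Such series are closed under products and
    under the divided powers c_m(f) = f^m / m!.

    With D = Delta/q acting on x, the equation reads
    g = u + b (c_q(Sg) - Dg c_(q-1)(Sg)), where S = 1 + qD is the shift.  Hence
    all D^n g are integral.  Modulo q, D is a derivation compatible with divided
    powers, c_(q-1)(g)^2 = 0, and (Dg)^2 c_(q-2)(g) c_(q-1)(g) = 0, because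
    'C(2q-2, q-1) is divisible by q.  Applying D to the equation and multiplying
    by c_(q-1)(g) gives Dg c_(q-1)(g) = Db c_q(g) c_(q-1)(g), which vanishes at
    each x since q^2 divides Delta b.  So g_0 satisfies g = u + c_q(g) modulo q,
    whose solution is unique: it is the series of the case b = 1. *)
Require Import Defs.
From mathcomp Require Import all_boot all_order all_algebra.
From mathcomp Require Import ring zify.

Set Implicit Arguments.
Unset Strict Implicit.
Unset Printing Implicit Defensive.

Import Order.TTheory GRing.Theory Num.Theory.
Local Open Scope ring_scope.

(** * Truncated Hurwitz series *)

Definition local_int (p : nat) (x : rat) : Prop :=
  exists2 d : nat, coprime p d & d%:R * x \is a Num.int.

Lemma local_int_int p (x : rat) : x \is a Num.int -> local_int p x.
Proof. by move=> xZ; exists 1%N; rewrite ?coprimen1 ?mul1r. Qed.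

Lemma local_int0 p : local_int p 0.
Proof. exact/local_int_int/rpred0. Qed.

Lemma local_intD p x y : local_int p x -> local_int p y -> local_int p (x + y).
Proof.
move=> [d cd xZ] [e ce yZ]; exists (d * e)%N; first by rewrite coprimeMr cd.
have -> : (d * e)%:R * (x + y) = e%:R * (d%:R * x) + d%:R * (e%:R * y).
  by rewrite natrM; ring.
by rewrite rpredD // rpredM // rpred_nat.
Qed.

Lemma local_intM p x y : local_int p x -> local_int p y -> local_int p (x * y).
Proof.
move=> [d cd xZ] [e ce yZ]; exists (d * e)%N; first by rewrite coprimeMr cd.
have -> : (d * e)%:R * (x * y) = (d%:R * x) * (e%:R * y) by rewrite natrM; ring.
exact: rpredM.
Qed.

Lemma local_int_sum p (I : finType) (F : I -> rat) :
  (forall i, local_int p (F i)) -> local_int p (\sum_i F i).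
Proof.
move=> FZ; elim/big_ind: _ => //; [exact: local_int0 | exact: local_intD].
Qed.

(* Working with polynomials modulo 'X^N stands in for power series. *)
Definition hurwitz (p N : nat) (f : {poly rat}) : Prop :=
  forall i, (i < N)%N -> local_int p (i`!%:R * f`_i).

Section Hurwitz.
Variable p : nat.

Lemma hurwitzD N f g : hurwitz p N f -> hurwitz p N g -> hurwitz p N (f + g).
Proof.
by move=> Hf Hg i ltiN; rewrite coefD mulrDr; apply: local_intD; auto.
Qed.

Lemma hurwitzZ N c f : local_int p c -> hurwitz p N f -> hurwitz p N (c *: f).
Proof.
by move=> Hc Hf i ltiN; rewrite coefZ mulrCA; apply: local_intM; auto.
Qed.

Lemma hurwitzC N c : local_int p c -> hurwitz p N c%:P.
Proof.
move=> Hc [|i] _; rewrite coefC /= ?mul1r // mulr0; exact: local_int0.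
Qed.

Lemma hurwitz0 N : hurwitz p N 0.
Proof. by move=> i _; rewrite coef0 mulr0; apply: local_int0. Qed.

Lemma hurwitzX N : hurwitz p N 'X.
Proof.
by move=> i _; apply: local_int_int; rewrite coefX rpredM ?rpred_nat.
Qed.

(** In the coordinates [i! f_i] a product is a binomial convolution. Integrality is asked of each
    pair of terms jointly, so that a vanishing term may cover an unknown one. *)
Lemma hurwitzM_coef (f g : {poly rat}) i :
  (forall j, (j <= i)%N ->
     local_int p (j`!%:R * f`_j * ((i - j)`!%:R * g`_(i - j)))) ->
  local_int p (i`!%:R * (f * g)`_i).
Proof.
move=> H; rewrite coefM mulr_sumr; apply: local_int_sum => j.
have leji : (j <= i)%N by rewrite -ltnS.
rewrite -(bin_fact leji) !natrM.
have -> : 'C(i, j)%:R * (j`!%:R * (i - j)`!%:R) * (f`_j * g`_(i - j)) =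
  'C(i, j)%:R * (j`!%:R * f`_j * ((i - j)`!%:R * g`_(i - j))) :> rat by ring.
by apply: local_intM; [apply/local_int_int/rpred_nat | apply: H].
Qed.

Lemma hurwitzM N f g : hurwitz p N f -> hurwitz p N g -> hurwitz p N (f * g).
Proof.
move=> Hf Hg i ltiN; apply: hurwitzM_coef => j leji.
by apply: local_intM; [apply: Hf|apply: Hg]; lia.
Qed.

(** The coefficient of [g] in degree [N] meets only the zero constant term of [f]. *)
Lemma hurwitzMr_rise N (f g : {poly rat}) :
  f`_0 = 0 -> hurwitz p N.+1 f -> hurwitz p N g ->
  hurwitz p N.+1 (f * g).
Proof.
move=> f0 Hf Hg i ltiN; apply: hurwitzM_coef => -[|j] leji.
  by rewrite f0 mulr0 mul0r; apply: local_int0.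
by apply: local_intM; [apply: Hf|apply: Hg]; lia.
Qed.

Lemma fact_coef_deriv (f : {poly rat}) i :
  i`!%:R * f^`()`_i = i.+1`!%:R * f`_i.+1.
Proof.
by rewrite coef_deriv -[_ *+ i.+1]mulr_natl mulrA -natrM mulnC -factS.
Qed.

Lemma hurwitz_deriv N f : hurwitz p N f -> hurwitz p N.-1 f^`().
Proof.
by move=> Hf i ltiN; rewrite fact_coef_deriv; apply: Hf; lia.
Qed.

Lemma hurwitz_primitive N (f : {poly rat}) :
  local_int p f`_0 -> hurwitz p N f^`() -> hurwitz p N.+1 f.
Proof.
move=> f0 Hf [|i] ltiN; first by rewrite mul1r.
by rewrite -fact_coef_deriv; apply: Hf.
Qed.

End Hurwitz.

(** * Divided powers *)

Definition divpow (m : nat) (f : {poly rat}) : {poly rat} :=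
  (m`!%:R)^-1 *: f ^+ m.

Lemma fact_neq0 m : (m`!)%:R != 0 :> rat.
Proof. by rewrite pnatr_eq0 -lt0n fact_gt0. Qed.

Lemma divpow0 f : divpow 0 f = 1.
Proof. by rewrite /divpow invr1 scale1r. Qed.

Lemma divpow1 f : divpow 1 f = f.
Proof. by rewrite /divpow invr1 scale1r. Qed.

Lemma divpowZ m c f : divpow m (c *: f) = c ^+ m *: divpow m f.
Proof. by rewrite /divpow exprZn !scalerA mulrC. Qed.

Lemma divpowD m f g :
  divpow m (f + g) = \sum_(i < m.+1) divpow i f * divpow (m - i) g.
Proof.
rewrite /divpow addrC exprDn scaler_sumr; apply: eq_bigr => i _.
have leim : (i <= m)%N by rewrite -ltnS.
rewrite -scalerAl -scalerAr scalerA -(bin_fact leim) !natrM -scaler_nat scalerA.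
rewrite [g ^+ _ * _]mulrC; congr (_ *: _).
have b0 : 'C(m, i)%:R != 0 :> rat by rewrite pnatr_eq0 -lt0n bin_gt0.
by field; rewrite b0 !fact_neq0.
Qed.

Lemma divpowM m n f :
  divpow m f * divpow n f = 'C(m + n, m)%:R *: divpow (m + n) f.
Proof.
rewrite /divpow -scalerAl -scalerAr !scalerA -exprD; congr (_ *: _).
rewrite -(bin_fact (leq_addr n m)) addKn !natrM.
have b0 : 'C(m + n, m)%:R != 0 :> rat.
  by rewrite pnatr_eq0 -lt0n bin_gt0 leq_addr.
by field; rewrite b0 !fact_neq0.
Qed.

Lemma divpow_coef0 m (f : {poly rat}) :
  (0 < m)%N -> f`_0 = 0 -> (divpow m f)`_0 = 0.
Proof.
case: m => // m _ f0.
by rewrite /divpow coefZ exprS coefM big_ord1 f0 mul0r mulr0.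
Qed.

Lemma deriv_divpow m f : (divpow m.+1 f)^`() = divpow m f * f^`().
Proof.
rewrite /divpow derivZ deriv_exp /= -scalerAl -scaler_nat scalerA.
congr (_ *: _).
  by rewrite factS natrM invfM mulrAC mulVf ?mul1r // pnatr_eq0.
by rewrite mulrC.
Qed.

(** By [deriv_divpow] the derivative involves a divided power of one order less; integrating back
    only shifts the coordinates [i! f_i], the constant term being zero. *)
Lemma hurwitz_divpow p N m (f : {poly rat}) :
  f`_0 = 0 -> hurwitz p N f -> hurwitz p N (divpow m f).
Proof.
move=> f0; elim: m N => [|m IHm] N Hf.
  by rewrite divpow0; apply/hurwitzC/local_int_int/rpred1.
case: N Hf => [|N] Hf; first by [].
apply: hurwitz_primitive; first by rewrite divpow_coef0 //; apply: local_int0.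
rewrite deriv_divpow; apply: hurwitzM; last exact: hurwitz_deriv Hf.
by apply: IHm => i ltiN; apply: Hf; lia.
Qed.

(** * Families of series with divisible differences *)

Definition qdiff (q : nat) (a : nat -> {poly rat}) : nat -> {poly rat} :=
  fun x => (q%:R)^-1 *: (a x.+1 - a x).

Fixpoint smooth_upto (p q N n : nat) (a : nat -> {poly rat}) : Prop :=
  (forall x, hurwitz p N (a x)) /\
  (if n is n'.+1 then smooth_upto p q N n' (qdiff q a) else True).

Definition smooth (p q N : nat) (a : nat -> {poly rat}) : Prop :=
  forall n, smooth_upto p q N n a.

Section Smooth.
Variables p q N : nat.
Implicit Types a b : nat -> {poly rat}.
Local Notation D := (qdiff q).
Local Notation smooth_upto := (smooth_upto p q N).
Local Notation smooth := (smooth p q N).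
Local Notation hurwitz := (hurwitz p N).

Lemma eq_qdiff a b : a =1 b -> D a =1 D b.
Proof. by move=> eqab x; rewrite /qdiff !eqab. Qed.

Lemma qdiff_coef0 a :
  (forall x, (a x)`_0 = 0) -> forall x, (D a x)`_0 = 0.
Proof. by move=> a0 x; rewrite coefZ coefB !a0 subrr mulr0. Qed.

Lemma eq_smooth_upto n a b : a =1 b -> smooth_upto n a -> smooth_upto n b.
Proof.
elim: n a b => [|n IHn] a b eqab /= [Ha Sa].
  by split=> // x; rewrite -eqab.
by split=> [x|]; [rewrite -eqab | apply: IHn (eq_qdiff eqab) Sa].
Qed.

Lemma smooth_upto_hurwitz n a x : smooth_upto n a -> hurwitz (a x).
Proof. by case: n => [|n] []. Qed.

Lemma smooth_uptoD n a b :
  smooth_upto n a -> smooth_upto n b -> smooth_upto n (fun x => a x + b x).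
Proof.
elim: n a b => [|n IHn] a b /= [Ha Sa] [Hb Sb].
  by split=> // x; apply: hurwitzD.
split=> [x|]; first exact: hurwitzD.
apply: eq_smooth_upto (IHn _ _ Sa Sb) => x.
by rewrite /qdiff -scalerDr; congr (_ *: _); ring.
Qed.

Lemma eq_smooth a b : a =1 b -> smooth a -> smooth b.
Proof. by move=> eqab Sa n; apply: eq_smooth_upto eqab (Sa n). Qed.

Lemma smooth_hurwitz a x : smooth a -> hurwitz (a x).
Proof. by move=> /(_ 0%N) []. Qed.

Lemma smooth_qdiff a : smooth a -> smooth (D a).
Proof. by move=> Sa n; case: (Sa n.+1). Qed.

Lemma smoothD a b : smooth a -> smooth b -> smooth (fun x => a x + b x).
Proof. by move=> Sa Sb n; apply: smooth_uptoD. Qed.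

Lemma smooth_uptoZ n c a :
  local_int p c -> smooth_upto n a -> smooth_upto n (fun x => c *: a x).
Proof.
move=> Hc; elim: n a => [|n IHn] a /= [Ha Sa].
  by split=> // x; apply: hurwitzZ.
split=> [x|]; first exact: hurwitzZ.
apply: eq_smooth_upto (IHn _ Sa) => x.
by rewrite /qdiff -scalerBr !scalerA mulrC.
Qed.

Lemma smoothZ c a : local_int p c -> smooth a -> smooth (fun x => c *: a x).
Proof. by move=> Hc Sa n; apply: smooth_uptoZ. Qed.

Lemma smoothN a : smooth a -> smooth (fun x => - a x).
Proof.
move=> Sa; apply: eq_smooth (smoothZ (local_int_int p (rpredN1 _)) Sa) => x.
by rewrite scaleN1r.
Qed.

Lemma smooth_upto_shift n a :
  smooth_upto n a -> smooth_upto n (fun x => a x.+1).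
Proof.
elim: n a => [|n IHn] a /= [Ha Sa]; first by split.
by split=> //; apply: IHn Sa.
Qed.

Lemma smooth_shift a : smooth a -> smooth (fun x => a x.+1).
Proof. by move=> Sa n; apply: smooth_upto_shift. Qed.

Lemma smooth_const f : hurwitz f -> smooth (fun=> f).
Proof.
move=> Hf n; elim: n f Hf => [|n IHn] f Hf; first by split.
split=> //.
apply: (@eq_smooth_upto _ (fun=> 0)) => [x|].
  by rewrite /qdiff subrr scaler0.
exact/IHn/hurwitz0.
Qed.

Lemma smooth_upto_sum n (I : Type) (r : seq I) (F : I -> nat -> {poly rat}) :
  (forall i, smooth_upto n (F i)) ->
  smooth_upto n (fun x => \sum_(i <- r) F i x).
Proof.
move=> SF; elim: r => [|i r IHr].
  apply: (@eq_smooth_upto n (fun=> 0)) => [x|]; first by rewrite big_nil.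
  exact/smooth_const/hurwitz0.
apply: (@eq_smooth_upto n (fun x => F i x + \sum_(j <- r) F j x)) => [x|].
  by rewrite big_cons.
exact: smooth_uptoD.
Qed.

Lemma qdiffM a b x :
  D (fun x => a x * b x) x = D a x * b x.+1 + a x * D b x.
Proof.
by rewrite /qdiff -scalerAl -scalerAr -scalerDr; congr (_ *: _); ring.
Qed.

Lemma smooth_uptoW n a : smooth_upto n.+1 a -> smooth_upto n a.
Proof.
elim: n a => [|n IHn] a [Ha Sa]; first by split.
by split=> //; apply: IHn.
Qed.

Lemma smooth_uptoM n a b :
  smooth_upto n a -> smooth_upto n b -> smooth_upto n (fun x => a x * b x).
Proof.
have HM k c d x : smooth_upto k c -> smooth_upto k d -> hurwitz (c x * d x).
  move=> Sc Sd.
  exact: hurwitzM (smooth_upto_hurwitz x Sc) (smooth_upto_hurwitz x Sd).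
elim: n a b => [|n IHn] a b Sa Sb.
  by split=> // x; apply: HM Sa Sb.
split=> [x|]; first exact: HM Sa Sb.
have S1 := IHn _ _ Sa.2 (smooth_upto_shift (smooth_uptoW Sb)).
have S2 := IHn _ _ (smooth_uptoW Sa) Sb.2.
by apply: eq_smooth_upto (smooth_uptoD S1 S2) => x; rewrite qdiffM.
Qed.

Lemma smoothM a b : smooth a -> smooth b -> smooth (fun x => a x * b x).
Proof. by move=> Sa Sb n; apply: smooth_uptoM. Qed.

Hypothesis q_gt0 : (0 < q)%N.

Lemma q_neq0 : q%:R != 0 :> rat.
Proof. by rewrite pnatr_eq0 -lt0n. Qed.

Lemma qdiffK a x : a x.+1 = q%:R *: D a x + a x.
Proof. by rewrite /qdiff scalerA mulfV ?q_neq0 // scale1r subrK. Qed.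

(** Expand [a (x+1) = a x + q D a x] by the divided binomial formula: every term that does not
    cancel has a factor [q], which pays for the division in [D]. *)
Lemma qdiff_divpow m a x :
  D (fun x => divpow m.+1 (a x)) x =
  \sum_(i < m.+1) q%:R ^+ i *: (divpow i.+1 (D a x) * divpow (m - i) (a x)).
Proof.
rewrite {1}/qdiff qdiffK divpowD big_ord_recl divpow0 mul1r subn0.
rewrite [X in X - _]addrC addrK scaler_sumr; apply: eq_bigr => i _.
rewrite divpowZ -scalerAl scalerA lift0 subSS; congr (_ *: _).
by rewrite exprS mulrA mulVf ?q_neq0 // mul1r.
Qed.

Lemma smooth_divpow m a :
  (forall x, (a x)`_0 = 0) -> smooth a -> smooth (fun x => divpow m (a x)).
Proof.
(* [m] and [a] stay free in the induction, because [qdiff_divpow] brings in divided powers of [D a]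
   of various orders. *)
move=> a0 Sa n; elim: n m a a0 Sa => [|n IHn] m a a0 Sa.
  by split=> // x; apply: hurwitz_divpow => //; apply: smooth_hurwitz.
split=> [x|]; first by apply: hurwitz_divpow => //; apply: smooth_hurwitz.
case: m => [|m].
  apply: (@eq_smooth_upto n (fun=> 0)); last exact/smooth_const/hurwitz0.
  by move=> x; rewrite /qdiff !divpow0 subrr scaler0.
apply: eq_smooth_upto (fun x => esym (qdiff_divpow m a x)) _.
have D0 := qdiff_coef0 a0.
apply: smooth_upto_sum => i; apply: smooth_uptoZ.
  by apply: local_int_int; rewrite rpredX ?rpred_nat.
by apply: smooth_uptoM; apply: IHn => //; apply: smooth_qdiff.
Qed.

(** Congruence to 0 modulo [q]. The quotient has to be smooth, and not only integral at each [x], so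
    that [D] preserves the relation. *)
Definition null a : Prop := smooth (fun x => (q%:R)^-1 *: a x).

Lemma eq_null a b : a =1 b -> null a -> null b.
Proof. by move=> eqab; apply: eq_smooth => x; rewrite eqab. Qed.

Lemma nullD a b : null a -> null b -> null (fun x => a x + b x).
Proof.
by move=> Na Nb; apply: eq_smooth (smoothD Na Nb) => x; rewrite scalerDr.
Qed.

Lemma nullM a b : smooth a -> null b -> null (fun x => a x * b x).
Proof.
by move=> Sa Nb; apply: eq_smooth (smoothM Sa Nb) => x; rewrite scalerAr.
Qed.

Lemma nullN a : null a -> null (fun x => - a x).
Proof.
by move=> Na; apply: eq_smooth (smoothN Na) => x; rewrite scalerN.
Qed.

Lemma null_scale m a : (q %| m)%N -> smooth a -> null (fun x => m%:R *: a x).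
Proof.
case/dvdnP=> c -> Sa.
apply: eq_smooth (smoothZ (local_int_int p (rpred_nat _ c)) Sa) => x.
by rewrite scalerA natrM mulrCA mulVf ?q_neq0 // mulr1.
Qed.

Lemma null_qdiff a : null a -> null (D a).
Proof.
move=> /smooth_qdiff Na; apply: eq_smooth Na => x.
by rewrite /qdiff -scalerBr.
Qed.

Lemma null_shift a : smooth a -> null (fun x => a x.+1 - a x).
Proof.
move=> Sa; apply: eq_null (null_scale (dvdnn q) (smooth_qdiff Sa)) => x.
by rewrite [in RHS]qdiffK addrK.
Qed.

(** The exact product rule shifts [b] in one term, and the shift is the identity modulo [q]. *)
Lemma null_leibniz a b : smooth a -> smooth b ->
  null (fun x => D (fun x => a x * b x) x - (D a x * b x + a x * D b x)).
Proof.
move=> Sa Sb; apply: eq_null (nullM (smooth_qdiff Sa) (null_shift Sb)) => x.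
by rewrite qdiffM; ring.
Qed.

(** In [qdiff_divpow] only the term [i = 0] lacks a factor [q]. *)
Lemma null_qdiff_divpow m a : (forall x, (a x)`_0 = 0) -> smooth a ->
  null (fun x => D (fun x => divpow m.+1 (a x)) x - D a x * divpow m (a x)).
Proof.
move=> a0 Sa.
have D0 := qdiff_coef0 a0.
apply: (@eq_null (fun x => q%:R *: \sum_(i < m)
    q%:R ^+ i *: (divpow i.+2 (D a x) * divpow (m - i.+1) (a x)))) => [x|].
  rewrite qdiff_divpow big_ord_recl expr0 scale1r subn0 divpow1.
  rewrite [RHS]addrC addKr scaler_sumr; apply: eq_bigr => i _.
  by rewrite scalerA -exprS.
apply: null_scale => // n; apply: smooth_upto_sum => i; apply: smooth_uptoZ.
  by apply: local_int_int; rewrite rpredX ?rpred_nat.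
by apply: smoothM; apply: smooth_divpow => //; apply: smooth_qdiff.
Qed.

End Smooth.

(** * The fixed-point equation modulo [q] *)

Lemma dvdn_bin_central m : (m.+1 %| 'C(m + m, m))%N.
Proof.
(* Catalan numbers are integers: [(2m+1) C(2m,m) = (m+1) C(2m+1,m+1)], and [m+1] is coprime to
   [2m+1]. *)
have co : coprime m.+1 (m + m).+1.
  rewrite coprime_sym -addnS /coprime gcdnC gcdnDr gcdnC.
  exact: coprimenS.
by rewrite -(Gauss_dvdr _ co) mul_bin_diag dvdn_mulr.
Qed.

(** Substituting [a x = a (x+1) - q D a x] turns a product whose integrality is not visible into
    divided powers at the single point [x+1]; the factor [q] reduces [1/q!] to [1/(q-1)!]. *)
Lemma mul_divpow_qdiff q a x : (0 < q)%N ->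
  (q`!%:R)^-1 *: (a x * a x.+1 ^+ q.-1) =
  divpow q (a x.+1) - qdiff q a x * divpow q.-1 (a x.+1).
Proof.
case: q => // q _ /=.
have -> : a x = a x.+1 - q.+1%:R *: qdiff q.+1 a x.
  by rewrite [in RHS](qdiffK (ltn0Sn q)) addrC addKr.
rewrite /divpow exprS mulrBl scalerBr -scalerAr -scalerAl scalerA.
congr (_ - _ *: _).
by rewrite factS natrM invfM mulrAC mulVf ?mul1r ?pnatr_eq0.
Qed.

Section Congruence.
Variables p m N : nat.
Local Notation q := m.+1.
Local Notation D := (qdiff q).
Local Notation smooth := (smooth p q N).
Local Notation null := (null p q N).
Local Notation hurwitz := (hurwitz p N).
Implicit Types a b g : nat -> {poly rat}.

Hypothesis m_gt0 : (0 < m)%N.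

Lemma null_divpow_sqr g : (forall x, (g x)`_0 = 0) -> smooth g ->
  null (fun x => divpow m (g x) * divpow m (g x)).
Proof.
move=> g0 Sg; apply: (@eq_null _ _ _
  (fun x => 'C(m + m, m)%:R *: divpow (m + m) (g x))) => [x|].
  by rewrite divpowM.
by apply: null_scale => //; [apply: dvdn_bin_central | apply: smooth_divpow].
Qed.

Lemma null_divpow_cross g : (forall x, (g x)`_0 = 0) -> smooth g ->
  null (fun x => D g x * D g x * divpow m.-1 (g x) * divpow m (g x)).
Proof.
move=> g0 Sg.
have D0 := qdiff_coef0 q g0.
apply: (@eq_null _ _ _ (fun x => 'C(m + m, m)%:R *:
  (divpow 2 (D g x) * divpow (m.-1 + m) (g x)))) => [x|].
  rewrite -mulrA divpowM -[D g x * D g x]expr2.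
  have -> : D g x ^+ 2 = 2%:R *: divpow 2 (D g x).
    by rewrite /divpow scalerA mulfV ?scale1r.
  move: (divpow 2 (D g x)) (divpow (m.-1 + m) (g x)) => u v.
  (* The 2 from the square of [D g] completes the central binomial coefficient:
     [2 C(2m-1,m-1) = C(2m,m)]. *)
  rewrite -scalerAl -scalerAr scalerA -natrM; congr (_%:R *: _).
  case: (m) m_gt0 => // k _ /=.
  rewrite addSn binS -(bin_sub (leq_addr k.+1 k)) addKn addnS.
  by rewrite mul2n addnn.
apply: null_scale => //; first by apply: dvdn_bin_central.
by apply: smoothM; apply: smooth_divpow => //; apply: smooth_qdiff.
Qed.

(** The unknown [D g] is eliminated in favour of the known [D b]; the values at 0 are inserted only
    in [tree_poly_fixpoint]. *)
Lemma null_fixpoint g b :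
  (forall x, (g x)`_0 = 0) -> smooth g -> smooth b ->
  null (fun x => g x - ('X + b x * ((q`!%:R)^-1 *: (g x * g x.+1 ^+ m)))) ->
  null (fun x => g x - ('X + b x * divpow q (g x)
                        - b x * D b x * (divpow q (g x) * divpow m (g x)))).
Proof.
move=> g0 Sg Sb fixg.
have SG k : smooth (fun x => divpow k (g x)) by apply: smooth_divpow.
have SD := smooth_qdiff Sg.
(* [R] is the right-hand side of [mul_divpow_qdiff] with the shift dropped, which is harmless modulo
   [q]. *)
set R := fun x => divpow q (g x) - D g x * divpow m (g x).
have SR : smooth R.
  exact: smoothD (SG q) (smoothN (smoothM SD (SG m))).
have fixR : null (fun x => g x - ('X + b x * R x)).
  have shifts := nullD (null_shift (ltn0Sn m) (SG q))
                       (nullN (nullM SD (null_shift (ltn0Sn m) (SG m)))).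
  apply: eq_null (nullD fixg (nullM Sb shifts)) => x.
  by rewrite -[m in _ ^+ m]/(q.-1) mul_divpow_qdiff //= /R; ring.
have fixD : null (fun x => D g x - (D b x * R x + b x * D R x)).
  apply: eq_null (nullD (null_qdiff fixR) (null_leibniz (ltn0Sn m) Sb SR)) => x.
  rewrite /qdiff -!scalerAl -!scalerAr -!scalerDr -!scalerBr -!scalerDr.
  by congr (_ *: _); ring.
have DR : null (fun x => D R x - (D g x * divpow m (g x)
    - (D (D g) x * divpow m (g x) + D g x * (D g x * divpow m.-1 (g x))))).
  have := null_leibniz (ltn0Sn m) SD (SG m).
  have := null_qdiff_divpow (ltn0Sn m) m g0 Sg.
  have := null_qdiff_divpow (ltn0Sn m) m.-1 g0 Sg.
  rewrite prednK // => Nm Nq Nl.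
  apply: eq_null (nullD Nq (nullN (nullD Nl (nullM SD Nm)))) => x.
  have -> : D R x = D (fun x => divpow q (g x)) x
                    - D (fun x => D g x * divpow m (g x)) x.
    by rewrite /R /qdiff -scalerBr; congr (_ *: _); ring.
  by ring.
have sqr := null_divpow_sqr g0 Sg.
have cross := null_divpow_cross g0 Sg.
(* Multiply [fixD] by [c_m(g)]. By [sqr] and [cross], [c_m(g) D R] vanishes and [c_m(g) R] reduces
   to [c_q(g) c_m(g)]; [S2] below gathers the coefficients of [c_m(g)^2]. *)
have key : null (fun x => D g x * divpow m (g x)
                          - D b x * (divpow q (g x) * divpow m (g x))).
  have N1 := nullM (SG m) (nullD fixD (nullM Sb DR)).
  have S2 := smoothD (smoothM Sb (smoothD SD (smoothN (smooth_qdiff SD))))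
                     (smoothN (smoothM (smooth_qdiff Sb) SD)).
  have N2 := nullD (nullM S2 sqr) (nullN (nullM Sb cross)).
  apply: eq_null (nullD N1 N2) => x.
  by rewrite /R; ring.
apply: eq_null (nullD fixR (nullN (nullM Sb key))) => x.
by rewrite /R; ring.
Qed.
End Congruence.

(** * Uniqueness of the fixed point *)

Lemma hurwitz_divpow_congr p N m c (f g : {poly rat}) :
  f`_0 = 0 -> g`_0 = 0 -> hurwitz p N f -> hurwitz p N g ->
  hurwitz p N (c *: (f - g)) -> hurwitz p N (c *: (divpow m f - divpow m g)).
Proof.
move=> f0 g0; elim: m N => [|m IHm] N Hf Hg Hfg.
  by rewrite !divpow0 subrr scaler0; apply: hurwitz0.
case: N Hf Hg Hfg => [|N] Hf Hg Hfg; first by [].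
apply: hurwitz_primitive.
  by rewrite coefZ coefB !divpow_coef0 // subrr mulr0; apply: local_int0.
have W h : hurwitz p N.+1 h -> hurwitz p N h.
  by move=> Hh i ltiN; apply: Hh; lia.
(* In use [c] is [1/q]. Differentiating splits the difference into one of lower order and one of
   [f - g], both covered by congruences already known. *)
have -> : (c *: (divpow m.+1 f - divpow m.+1 g))^`() =
    c *: (divpow m f - divpow m g) * f^`() + divpow m g * (c *: (f - g))^`().
  rewrite !derivZ !derivB !deriv_divpow; move: (divpow m f) (divpow m g) => u v.
  by rewrite -scalerAl -scalerAr -scalerDr; congr (_ *: _); ring.
apply: hurwitzD; apply: hurwitzM; first by apply: IHm; apply: W.
- exact: hurwitz_deriv Hf.
- by apply: hurwitz_divpow => //; apply: W.
- exact: hurwitz_deriv Hfg.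
Qed.

(** For an exponent at least 2, the divided power in front of [(f - g)'] still has zero constant
    term: this regains the degree lost by differentiating, and integration adds one more. *)
Lemma hurwitz_divpow_congr_rise p N m c (f g : {poly rat}) :
  f`_0 = 0 -> g`_0 = 0 -> hurwitz p N.+1 f -> hurwitz p N g ->
  hurwitz p N (c *: (f - g)) ->
  hurwitz p N.+1 (c *: (divpow m.+2 f - divpow m.+2 g)).
Proof.
move=> f0 g0 Hf Hg Hfg.
apply: hurwitz_primitive.
  by rewrite coefZ coefB !divpow_coef0 // subrr mulr0; apply: local_int0.
case: N Hf Hg Hfg => [|N] Hf Hg Hfg; first by [].
have -> : (c *: (divpow m.+2 f - divpow m.+2 g))^`() =
    c *: (divpow m.+1 f - divpow m.+1 g) * f^`()
    + divpow m.+1 g * (c *: (f - g))^`().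
  rewrite !derivZ !derivB !deriv_divpow.
  move: (divpow m.+1 f) (divpow m.+1 g) => u v.
  by rewrite -scalerAl -scalerAr -scalerDr; congr (_ *: _); ring.
apply: hurwitzD.
  apply: hurwitzM; last exact: hurwitz_deriv Hf.
  by apply: hurwitz_divpow_congr => // i ltiN; apply: Hf; lia.
apply: hurwitzMr_rise; first by rewrite divpow_coef0.
  exact: hurwitz_divpow.
exact: hurwitz_deriv Hfg.
Qed.

Lemma hurwitz_fixpoint_unique p N m c (f g : {poly rat}) :
  f`_0 = 0 -> g`_0 = 0 -> hurwitz p N f -> hurwitz p N g ->
  hurwitz p N (c *: (f - ('X + divpow m.+2 f))) ->
  hurwitz p N (c *: (g - ('X + divpow m.+2 g))) ->
  hurwitz p N (c *: (f - g)).
Proof.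
move=> f0 g0 Hf Hg fixf fixg.
(* Induction on the order up to which [f] and [g] agree: the difference of the two equations
   expresses [f - g] by divided powers, known to one degree more. *)
suff H M : (M <= N)%N -> hurwitz p M (c *: (f - g)) by apply: H.
elim: M => [|M IHM] leMN; first by [].
have W K h : (K <= N)%N -> hurwitz p N h -> hurwitz p K h.
  by move=> leKN Hh i ltiK; apply: Hh; lia.
have -> : c *: (f - g) = c *: (f - ('X + divpow m.+2 f))
    + (-1) *: (c *: (g - ('X + divpow m.+2 g)))
    + c *: (divpow m.+2 f - divpow m.+2 g).
  by rewrite scaleN1r -scalerBr -scalerDr; congr (_ *: _); ring.
have Z1 : local_int p (-1) by apply/local_int_int/rpredN1.
apply: hurwitzD.
  by apply: hurwitzD; [|apply: hurwitzZ => //]; apply: W.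
apply: hurwitz_divpow_congr_rise => //; [exact: W|apply: W => //; lia|].
by apply: IHM; lia.
Qed.

Lemma smooth_vanish p q N (a : nat -> {poly rat}) :
  (forall x i, (i < N)%N -> (a x)`_i = 0) -> smooth p q N a.
Proof.
move=> a0 n; elim: n a a0 => [|n IHn] a a0.
  by split=> // x i ltiN; rewrite a0 // mulr0; apply: local_int0.
split=> [x i ltiN|]; first by rewrite a0 // mulr0; apply: local_int0.
by apply: IHn => x i ltiN; rewrite coefZ coefB !a0 // subrr mulr0.
Qed.

Lemma smooth_int p q N (b : nat -> int) : (0 < q)%N ->
  (forall n x, (q%:Z ^+ n %| iter n fdiff b x)%Z) ->
  smooth p q N (fun x => (b x)%:~R%:P).
Proof.
move=> q_gt0 Hb n.
have q0 : q%:R != 0 :> rat by rewrite pnatr_eq0 -lt0n.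
(* After [e] steps the family is the [e]-fold difference of [b] divided by [q^e]; carrying that
   power makes the claim inductive. *)
suff H e (c : nat -> int) :
    (forall n x, (q%:Z ^+ (n + e) %| iter n fdiff c x)%Z) ->
    smooth_upto p q N n (fun x => ((q%:R ^+ e)^-1 * (c x)%:~R)%:P).
  apply: eq_smooth_upto (H 0%N b _) => [x|k x].
    by rewrite expr0 invr1 mul1r.
  by rewrite addn0.
have I d k x : (q%:Z ^+ d %| k)%Z -> hurwitz p x ((q%:R ^+ d)^-1 * k%:~R)%:P.
  case/dvdzP=> z ->; apply/hurwitzC/local_int_int.
  rewrite rmorphM /= rmorphXn /= mulrCA mulVf ?mulr1 ?intr_int //.
  by rewrite expf_neq0.
elim: n e c => [|n IHn] e c Hc.
  by split=> // x; apply: I; apply: (Hc 0%N).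
split=> [x|]; first by apply: I; apply: (Hc 0%N).
apply: eq_smooth_upto (IHn e.+1 (fdiff c) _) => [x|k x].
  rewrite /qdiff -polyCB -mul_polyC -polyCM -mulrBr mulrA exprS invfM.
  by rewrite /fdiff rmorphB.
by rewrite -iterSr addnS -addSn.
Qed.

(** * Tree polynomials *)

(* The variable marks the leaves, that is, the empty child positions. *)
Definition tree_poly (b : nat -> int) (q h x : nat) : {poly rat} :=
  \sum_(T : qtree q h)
    ((wt (fun i => b (x + i)%N) T)%:~R / q`!%:R ^+ size (vertices T))
      *: 'X^((q.-1 * size (vertices T)).+1).

Lemma tree_poly0 b q x : tree_poly b q 0 x = 'X.
Proof.
rewrite /tree_poly (big_pred1 (tt : qtree q 0)) => [|[]] //=.
by rewrite /wt big_nil muln0 expr0 divr1 scale1r expr1.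
Qed.

Lemma big_option (V : nmodType) (T : finType) (F : option T -> V) :
  \sum_o F o = F None + \sum_x F (Some x).
Proof.
rewrite (bigD1 None) //=; congr (_ + _).
rewrite (reindex_omap Some id) => [|[]] //=.
by apply: eq_bigl => x; rewrite eqxx.
Qed.

Lemma size_vertices_Some q h (f : {ffun 'I_q -> qtree q h}) :
  size (vertices (Some f : qtree q h.+1)) = (\sum_i size (vertices (f i))).+1.
Proof.
rewrite /= size_allpairs_dep sumnE big_map big_enum //.
Qed.

Lemma wt_Some b q h (f : {ffun 'I_q -> qtree q h}) :
  wt b (Some f : qtree q h.+1) =
  b 0%N * \prod_i wt (fun j => b (non_right i + j)%N) (f i).
Proof.
rewrite /wt /= big_cons big_allpairs_dep big_enum //.
Qed.

Lemma tree_polyS b m h x :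
  tree_poly b m.+1 h.+1 x =
  'X + ((b x)%:~R / m.+1`!%:R)
         *: (tree_poly b m.+1 h x * tree_poly b m.+1 h x.+1 ^+ m).
Proof.
(* One factor per child position: only the last keeps the index [x]. Distributing the product over
   the sums chooses a subtree for each position. *)
transitivity ('X + ((b x)%:~R / m.+1`!%:R) *:
    \prod_(i < m.+1) tree_poly b m.+1 h (x + non_right i)); last first.
  congr (_ + _ *: _); rewrite big_ord_recr /= {2}/non_right eqxx addn0 mulrC.
  congr (_ * _); rewrite (eq_bigr (fun=> tree_poly b m.+1 h x.+1)) => [|i _].
    by rewrite prodr_const card_ord.
  by rewrite /non_right /= eqSS ltn_eqF // addn1.
rewrite {1}/tree_poly big_option; congr (_ + _).
  by rewrite /wt /= big_nil muln0 expr0 divr1 scale1r expr1.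
rewrite bigA_distr_bigA scaler_sumr; apply: eq_bigr => f _.
rewrite size_vertices_Some wt_Some addn0 /=.
rewrite scaler_prod scalerA big_split /= prodfV !prodrXr rmorphM /=.
rewrite rmorph_prod /=.
(* Leaves add up over the [m+1] positions: [m (1 + sum s_i) + 1 = sum (m s_i + 1)]. *)
congr (_ *: 'X^_); last first.
  rewrite [RHS](eq_bigr (fun i => m * size (vertices (f i)) + 1)%N) => [|i _].
    by rewrite big_split -big_distrr sum1_card card_ord /= mulnS addnS addnC.
  by rewrite addn1.
rewrite [in RHS](eq_bigr
  (fun i => (wt (fun j => b (x + (non_right i + j))%N) (f i))%:~R : rat))
    => [|i _].
  by rewrite exprS invfM; ring.
by congr (_%:~R); apply: eq_bigr => v _; rewrite addnA.
Qed.

Lemma tree_poly_coef0 b m h x : (tree_poly b m.+1 h x)`_0 = 0.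
Proof.
elim: h x => [|h IHh] x; first by rewrite tree_poly0 coefX.
by rewrite tree_polyS coefD coefX coefZ coefM big_ord1 IHh mul0r mulr0.
Qed.

Lemma tree_poly_dvdX b m h x : 'X %| tree_poly b m.+1 h x.
Proof.
by rewrite -['X]subr0 -polyC0 dvdp_XsubCl /root horner_coef0 tree_poly_coef0.
Qed.

(** Each further factor is divisible by [X] and raises the order of agreement by one. *)
Lemma dvdp_subX_rise (N m : nat) (f g : {poly rat}) :
  'X %| f -> 'X %| g -> 'X^N %| f - g -> 'X^(N + m) %| f ^+ m.+1 - g ^+ m.+1.
Proof.
move=> Xf Xg Nfg; elim: m => [|m IHm]; first by rewrite addn0 !expr1.
have -> : f ^+ m.+2 - g ^+ m.+2 =
    f * (f ^+ m.+1 - g ^+ m.+1) + (f - g) * g ^+ m.+1.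
  by rewrite !exprS; ring.
rewrite dvdp_add //; first by rewrite addnS exprS dvdp_mul.
by rewrite exprD dvdp_mul ?dvdp_exp2r.
Qed.

(** A tree with exactly [h+1] levels has at least [h+1] vertices, hence at least [m(h+1)+1] leaves.
    The proof gets this bound from the recursion, where each of the [m] remaining factors adds a
    degree. *)
Lemma tree_poly_stable b m h x :
  'X^((m * h.+1).+1) %| tree_poly b m.+1 h.+1 x - tree_poly b m.+1 h x.
Proof.
elim: h x => [|h IHh] x.
  rewrite tree_polyS !tree_poly0 addrC addKr muln1 -exprS.
  by rewrite -mul_polyC dvdp_mull ?dvdpp.
rewrite tree_polyS [X in _ - X]tree_polyS opprD addrACA subrr add0r.
rewrite -scalerBr -mul_polyC dvdp_mull //.
set f := tree_poly b m.+1 h.+1; set g := tree_poly b m.+1 h.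
have -> : f x * f x.+1 ^+ m - g x * g x.+1 ^+ m =
    (f x - g x) * f x.+1 ^+ m + g x * (f x.+1 ^+ m - g x.+1 ^+ m) by ring.
have -> : (m * h.+2).+1 = ((m * h.+1).+1 + m)%N by rewrite mulnS; lia.
rewrite dvdp_add //.
  by rewrite exprD dvdp_mul ?dvdp_exp2r ?tree_poly_dvdX ?IHh.
case: (m) IHh @f @g => [|k] IHh f g; first by rewrite !expr0 subrr mulr0 dvdp0.
rewrite addnS exprS dvdp_mul ?tree_poly_dvdX //.
by rewrite dvdp_subX_rise ?tree_poly_dvdX ?IHh.
Qed.

Lemma coef_eq_dvdXn (N i : nat) (f g : {poly rat}) :
  'X^N %| f - g -> (i < N)%N -> f`_i = g`_i.
Proof.
case/dvdpP=> r E ltiN; apply/eqP; rewrite -subr_eq0 -coefB E coefMXn.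
by rewrite ltiN.
Qed.

Lemma coef_tree_poly b q n : (1 < q)%N ->
  (tree_poly b q n 0)`_(q.-1 * n).+1 = (wqcatalan b q n)%:~R / q`!%:R ^+ n.
Proof.
move=> q_gt1.
rewrite /tree_poly coef_sumMXn /wqcatalan rmorph_sum /= mulr_suml.
apply: eq_big => [T|T]; first by rewrite /= eqSS eqn_pmul2l //; lia.
by rewrite eqSS eqn_pmul2l; [move=> /eqP -> | lia].
Qed.

(** The recursion is put in the form of [mul_divpow_qdiff], where the division by [q!] is absorbed
    by divided powers. *)
Lemma smooth_tree_poly p m N b h :
  (forall n x, (m.+1%:Z ^+ n %| iter n fdiff b x)%Z) ->
  smooth p m.+1 N (tree_poly b m.+1 h).
Proof.
move=> Hb; elim: h => [|h IHh].
  apply: (@eq_smooth _ _ _ (fun=> 'X)) => [x|]; first by rewrite tree_poly0.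
  exact/smooth_const/hurwitzX.
set g := tree_poly b m.+1 h.
have SG k : smooth p m.+1 N (fun x => divpow k (g x)).
  by apply: smooth_divpow => // x; apply: tree_poly_coef0.
apply: (@eq_smooth _ _ _ (fun x => 'X + (b x)%:~R%:P *
    (divpow m.+1 (g x.+1) - qdiff m.+1 g x * divpow m (g x.+1)))) => [x|].
  rewrite tree_polyS -mul_divpow_qdiff // -/g.
  by rewrite mul_polyC scalerA.
apply: smoothD; first exact/smooth_const/hurwitzX.
apply: smoothM; first exact: smooth_int.
apply: smoothD; first exact: (smooth_shift (SG m.+1)).
apply: smoothN; apply: smoothM; first exact: smooth_qdiff.
exact: (smooth_shift (SG m)).
Qed.

Lemma tree_poly_fixpoint p m N b h : (0 < m)%N -> (N <= (m * h.+1).+1)%N ->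
  (m.+1 %| b 0%N - 1)%Z -> (m.+1%:Z ^+ 2 %| fdiff b 0%N)%Z ->
  (forall n x, (m.+1%:Z ^+ n %| iter n fdiff b x)%Z) ->
  hurwitz p N (m.+1%:R^-1 *: (tree_poly b m.+1 h 0
                              - ('X + divpow m.+1 (tree_poly b m.+1 h 0)))).
Proof.
move=> m_gt0 leN /dvdzP[c Ec] /dvdzP[d Ed] Hb.
set g := tree_poly b m.+1 h; set B := fun x => (b x)%:~R%:P : {poly rat}.
have g0 x : (g x)`_0 = 0 by apply: tree_poly_coef0.
have Sg : smooth p m.+1 N g by apply: smooth_tree_poly.
have fixg : null p m.+1 N (fun x => g x - ('X + B x *
    ((m.+1`!%:R)^-1 *: (g x * g x.+1 ^+ m)))).
  (* At finite height the equation fails only by the difference between heights [h] and [h+1], which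
     is zero below degree [m(h+1)+1]. *)
  apply: smooth_vanish => x i ltiN; rewrite coefZ.
  have -> : 'X + B x * ((m.+1`!%:R)^-1 *: (g x * g x.+1 ^+ m)) =
      tree_poly b m.+1 h.+1 x by rewrite tree_polyS /B mul_polyC scalerA.
  rewrite coefB (coef_eq_dvdXn (tree_poly_stable b m h x)) ?subrr ?mulr0 //.
  exact: leq_trans ltiN leN.
have SB := smooth_int p N (ltn0Sn m) Hb.
have := smooth_hurwitz 0%N (null_fixpoint m_gt0 g0 Sg SB fixg).
set u := divpow m.+1 (g 0%N); set v := divpow m (g 0%N) => H.
have Hu : hurwitz p N u by apply: hurwitz_divpow => //; apply: smooth_hurwitz.
have Hv : hurwitz p N v by apply: hurwitz_divpow => //; apply: smooth_hurwitz.
have q0 : m.+1%:R != 0 :> rat by rewrite pnatr_eq0.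
have {Ec} Ec : (b 0%N)%:~R = 1 + c%:~R * m.+1%:R :> rat.
  by move/eqP: Ec; rewrite subr_eq addrC => /eqP->; rewrite rmorphD rmorphM.
(* As [q^2] divides the difference of [b] at 0, a factor [q] survives the division in [D] and
   removes the mixed term. *)
have {Ed} Ed : qdiff m.+1 B 0%N = (d%:~R * m.+1%:R)%:P.
  rewrite /qdiff /B -polyCB -rmorphB -mul_polyC -polyCM -/(fdiff b 0%N) Ed.
  congr (_%:P); rewrite rmorphM rmorphXn /=.
  by field; rewrite addrC natr1.
have -> : m.+1%:R^-1 *: (g 0%N - ('X + u)) =
   m.+1%:R^-1 *: (g 0%N - ('X + B 0%N * u - B 0%N * qdiff m.+1 B 0%N * (u * v)))
   + c%:~R *: u + (- ((b 0%N)%:~R * d%:~R)) *: (u * v).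
  rewrite Ed /B -polyCM !mul_polyC; clearbody u v; move: (u * v) (g 0%N) => w x.
  apply/polyP=> i; rewrite !(coefD, coefN, coefZ) Ec.
  by field; rewrite addrC natr1.
apply: hurwitzD; last first.
  apply: hurwitzZ; last exact: hurwitzM.
  by apply: local_int_int; rewrite rpredN rpredM // intr_int.
by apply: hurwitzD => //; apply: hurwitzZ => //; apply/local_int_int/intr_int.
Qed.

(** * Counting trees *)

(* The Raney number r / (r + (m+1)k) * 'C(r + (m+1)k, k), which counts the
   forests of r trees with k vertices in all. *)
Definition raney (m k r : nat) : rat :=
  if k is k'.+1 then r%:R * ((r + m.+1 * k).-1 ^_ k')%:R / k`!%:R else 1.

(** The first of [r+1] trees is empty, or has a root whose [m+1] subtrees join the other [r] trees.
    The proof is a computation with the closed formula. *)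
Lemma raney_rec m k r :
  raney m k.+1 r.+1 = raney m k.+1 r + raney m k (r + m.+1).
Proof.
case: k => [|k].
  by rewrite /raney !ffactn0 (_ : 1`! = 1)%N // !mulr1n; field.
rewrite /raney.
have [M EM] : exists M, (r + m.+1 * k.+2)%N = M.+1.
  by exists (r + m + m.+1 * k.+1)%N; rewrite mulnS; lia.
have -> : (r + m.+1 + m.+1 * k.+1)%N = M.+1 by rewrite -EM [in RHS]mulnS addnA.
rewrite addSn EM /= ffactSS ffactnSr.
have leM : (k <= M)%N by rewrite -ltnS -EM; nia.
(* Eliminating [m] leaves a rational identity in [M], [r], [k] and a common falling factorial. *)
have ER : (r + m.+1)%:R = (M.+1 + r * k.+1)%:R / k.+2%:R :> rat.
  have -> : (M.+1 + r * k.+1 = (r + m.+1) * k.+2)%N by rewrite -EM; ring.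
  by rewrite natrM mulfK // pnatr_eq0.
rewrite ER [k.+2`!]factS; move: (k.+1`!) (fact_neq0 k.+1) => F F0.
rewrite !natrM natrB //.
by field; rewrite F0 -natrD pnatr_eq0.
Qed.

Lemma raney1 m n : raney m n 1 = (qcatalan m.+1 n)%:R.
Proof.
case: n => [|n]; first by rewrite /qcatalan !muln0 bin0 divn1.
have E := qcatalanE n.+1 (ltn0Sn m).
have := bin_ffact (m.+1 * n.+1) n.+1; rewrite -E ffactnSr /=.
have -> : (m.+1 * n.+1 - n = (m * n.+1).+1)%N by rewrite mulSn; lia.
rewrite -mulnA [RHS]mulnC => /eqP; rewrite eqn_pmul2l // => /eqP H.
by rewrite /raney /= mul1r -H natrM mulfK // fact_neq0.
Qed.

(** A forest of [r] trees with [k] vertices has [mk + r] leaves. The recursion for [H] times a power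
    of [H] is the recurrence [raney_rec], valid below the truncation order. *)
Lemma coef_tree_poly1_exp m n k r : (0 < m)%N -> (k <= n)%N ->
  m.+1`!%:R ^+ k * (tree_poly (fun=> 1) m.+1 n 0 ^+ r)`_(m * k + r) =
  raney m k r.
Proof.
move=> m_gt0; set H := tree_poly _ _ _ _.
have f0 := fact_neq0 m.+1.
have step j s : (j <= n)%N -> (H ^+ s.+1)`_(m * j + s.+1) =
    (H ^+ s)`_(m * j + s) + (m.+1`!%:R)^-1 * (H ^+ (s + m.+1))`_(m * j + s.+1).
  move=> lejn; rewrite -coefZ.
  have -> : (H ^+ s)`_(m * j + s) = (H ^+ s * 'X)`_(m * j + s.+1).
    by rewrite coefMX addnS.
  rewrite -coefD; apply: (@coef_eq_dvdXn (s + (m * n.+1).+1)); last by nia.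
  have := tree_poly_stable (fun=> 1) m n 0.
  rewrite tree_polyS -/H -[tree_poly _ _ _ 1]/H -exprS mul1r => dvdH.
  have -> : H ^+ s.+1 - (H ^+ s * 'X + (m.+1`!%:R)^-1 *: H ^+ (s + m.+1)) =
      - (H ^+ s * ('X + (m.+1`!%:R)^-1 *: H ^+ m.+1 - H)).
    rewrite exprD scalerAr exprSr; ring.
  rewrite dvdpNr exprD dvdp_mul //.
  by rewrite dvdp_exp2r ?tree_poly_dvdX.
elim: k r => [|k IHk] r lekn.
  rewrite mul1r; elim: r => [|r IHr]; first by rewrite expr0 muln0 coef1.
  rewrite step // IHr muln0 add0n.
  suff -> : (H ^+ (r + m.+1))`_r.+1 = 0 by rewrite mulr0 addr0.
  rewrite (@coef_eq_dvdXn (r + m.+1) _ _ 0) ?coef0 //; last by lia.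
  by rewrite subr0 dvdp_exp2r ?tree_poly_dvdX.
elim: r => [|r IHr].
  rewrite expr0 coef1 addn0 muln_eq0 eqn0Ngt m_gt0 mulr0.
  by rewrite /raney !mul0r.
rewrite raney_rec step // mulrDr IHr; congr (_ + _).
rewrite -IHk; last by lia.
have -> : (m * k.+1 + r.+1 = m * k + (r + m.+1))%N by rewrite mulnS; lia.
by rewrite exprSr -mulrA mulVKf.
Qed.

(** This turns the closed formula into a tree sum, so that both sides of the congruence are
    coefficients of tree polynomials. *)
Lemma wqcatalan1 q n : (1 < q)%N -> wqcatalan (fun=> 1) q n = (qcatalan q n)%:Z.
Proof.
case: q => // m m_gt0.
have := coef_tree_poly1_exp 1 m_gt0 (leqnn n).
rewrite expr1 addn1 raney1 (coef_tree_poly _ _ m_gt0).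
rewrite mulrC divfK ?expf_neq0 ?fact_neq0 // => /eqP.
by rewrite -[_%:R]/((qcatalan m.+1 n)%:Z%:~R) eqr_int => /eqP.
Qed.

Lemma tree_poly_congr p m N b h : (0 < m)%N -> (N <= (m * h.+1).+1)%N ->
  (m.+1 %| b 0%N - 1)%Z -> (m.+1%:Z ^+ 2 %| fdiff b 0%N)%Z ->
  (forall n x, (m.+1%:Z ^+ n %| iter n fdiff b x)%Z) ->
  hurwitz p N (m.+1%:R^-1 *: (tree_poly b m.+1 h 0
                              - tree_poly (fun=> 1) m.+1 h 0)).
Proof.
move=> m_gt0 leN b1 b2 Hb.
have H1 n x : (m.+1%:Z ^+ n %| iter n fdiff (fun=> 1) x)%Z.
  case: n => [|n]; first by rewrite dvd1z.
  suff -> : iter n.+1 fdiff (fun=> 1) x = 0 by rewrite dvdz0.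
  elim: n x => [|n IHn] x; first by rewrite /= /fdiff subrr.
  by rewrite iterS /fdiff !IHn subrr.
have fix1 := tree_poly_fixpoint p m_gt0 leN b1 b2 Hb.
have fix2 := @tree_poly_fixpoint p m N (fun=> 1) h
  m_gt0 leN (dvdz0 _) (dvdz0 _) H1.
case: m m_gt0 leN b1 b2 Hb H1 fix1 fix2 => // m _ leN _ _ Hb H1.
by apply: hurwitz_fixpoint_unique; rewrite ?tree_poly_coef0 //;
  apply: smooth_hurwitz; apply: smooth_tree_poly.
Qed.

(** * Valuations *)

Lemma logn_fact_wide p N M : prime p -> (N <= M)%N ->
  logn p N`! = (\sum_(i < M) N %/ p ^ i.+1)%N.
Proof.
move=> p_pr leNM; rewrite logn_fact // big_add1 /= big_mkord.
rewrite (big_ord_widen _ (fun i => N %/ p ^ i.+1)%N leNM) big_mkcond /=.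
apply: eq_bigr => i _; case: ltnP => // leNi; rewrite divn_small //.
apply: leq_trans (ltn_expl _ (prime_gt1 p_pr)) _.
by rewrite leq_exp2l ?prime_gt1 //; lia.
Qed.

Lemma legendre p N : prime p -> (digit_sum p N + p.-1 * logn p N`! = N)%N.
Proof.
move=> p_pr.
have Elog := logn_fact_wide p_pr (leqnn N).
have E1 : (\sum_(i < N) N %/ p ^ i = N + logn p N`!)%N.
  case: N Elog => [|N] Elog; first by rewrite big_ord0 fact0 logn1.
  rewrite big_ord_recl expn0 divn1; congr (_ + _)%N.
  rewrite Elog big_ord_recr /= [(N.+1 %/ _)%N]divn_small ?addn0 //.
  exact: ltn_expl (prime_gt1 p_pr).
(* Euclidean division of [N %/ p ^ i] by [p]: the quotients sum to the valuation of [N!], the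
   remainders are the digits. *)
have E2 : (\sum_(i < N) N %/ p ^ i = p * logn p N`! + digit_sum p N)%N.
  rewrite Elog big_distrr -big_split /=; apply: eq_bigr => i _.
  by rewrite expnSr divnMA mulnC -divn_eq.
have p_gt0 := prime_gt0 p_pr.
have Ep : (p * logn p N`! = p.-1 * logn p N`! + logn p N`!)%N.
  by rewrite -mulSnr prednK.
lia.
Qed.

Lemma logn_fact_mulp p N : prime p -> logn p (p * N)`! = (N + logn p N`!)%N.
Proof.
move=> p_pr; have p_gt1 := prime_gt1 p_pr.
case: N => [|N]; first by rewrite muln0.
case EM: (p * N.+1)%N => [|M]; first by nia.
(* Here [p (N+1) = M+1]; letting the sum for [N+1] run to [M] makes both lengths match after a shift
   by one term. *)
have leNM : (N.+1 <= M)%N by nia.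
rewrite (logn_fact_wide p_pr (leqnn _)) (logn_fact_wide p_pr leNM).
transitivity (\sum_(i < M.+1) N.+1 %/ p ^ i)%N; last first.
  by rewrite big_ord_recl expn0 divn1.
by apply: eq_bigr => i _; rewrite -[X in (X %/ _)%N]EM expnS divnMl ?prime_gt0.
Qed.

Lemma logn_fact_mul_exp p k N : prime p ->
  logn p (p ^ k * N)`! = (logn p N`! + N * logn p (p ^ k)`!)%N.
Proof.
move=> p_pr; elim: k => [|k IHk]; first by rewrite mul1n logn1 muln0 addn0.
rewrite expnS -mulnA !(logn_fact_mulp _ p_pr) IHk; ring.
Qed.

Lemma logn_fact_exp p k : prime p -> (p.-1 * logn p (p ^ k)`! = (p ^ k).-1)%N.
Proof.
move=> p_pr; elim: k => [|k IHk]; first by rewrite logn1 muln0.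
rewrite expnS (logn_fact_mulp _ p_pr) mulnDr IHk.
have := expn_gt0 p k; rewrite (prime_gt0 p_pr) /= => pk_gt0.
have := prime_gt0 p_pr; nia.
Qed.

(** Take valuations in [C_n ((q-1)n+1)! n! = (qn)!]; the valuation of [n!] cancels. *)
Lemma logn_qcatalan p k n (q := (p ^ k)%N) : prime p ->
  (logn p (qcatalan q n) + logn p ((q.-1 * n).+1)`! = n * logn p q`!)%N.
Proof.
move=> p_pr; have q_gt0 : (0 < q)%N by rewrite expn_gt0 prime_gt0.
have E := qcatalanE n q_gt0.
have leq : (n <= q * n)%N by rewrite leq_pmull.
have := bin_fact leq; rewrite -E.
have -> : (q * n - n = q.-1 * n)%N by rewrite -{2}[n]mul1n -mulnBl subn1.
move=> F.
have C0 : (0 < qcatalan q n)%N.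
  by have := bin_gt0 (q * n) n; rewrite leq -E muln_gt0 => /andP[].
have : logn p (q * n)`! =
    (logn p (qcatalan q n * (q.-1 * n).+1`!) + logn p n`!)%N.
  rewrite -lognM ?muln_gt0 ?C0 ?fact_gt0 // -F factS; congr logn; ring.
by rewrite lognM ?C0 ?fact_gt0 // logn_fact_mul_exp // -/q addnC => /addIn ->.
Qed.

Lemma dvdz_of_local_int p j K M (d : int) : prime p -> (0 < K)%N -> (0 < M)%N ->
  logn p K = (j + logn p M)%N -> local_int p (M%:R * d%:~R / K%:R) ->
  (p%:Z ^+ j %| d)%Z.
Proof.
move=> p_pr K_gt0 M_gt0 EK [e ce /intrP[z Ez]].
have {}Ez : e%:Z * (M%:Z * d) = z * K%:Z.
  apply: (@intr_inj rat); rewrite !rmorphM /= -Ez -!mulrA mulVf ?mulr1 //.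
  by rewrite pnatr_eq0 -lt0n.
(* Valuations cannot be compared at [d = 0], where [logn] is 0 by convention. *)
have [-> |d0] := eqVneq d 0; first exact: dvdz0.
have e_gt0 : (0 < e)%N.
  case: e ce {Ez} => //; rewrite /coprime gcdn0 => /eqP p1.
  by rewrite p1 in p_pr.
have d_gt0 : (0 < `|d|)%N by rewrite absz_gt0.
have {}Ez : (e * (M * `|d|) = `|z| * K)%N.
  by move/(congr1 absz): Ez; rewrite !abszM.
have z_gt0 : (0 < `|z|)%N.
  by move: Ez; case: `|z|%N => // Ez; move: Ez d_gt0 M_gt0 e_gt0; nia.
have := congr1 (logn p) Ez; rewrite !lognM ?muln_gt0 ?M_gt0 //.
have -> : logn p e = 0%N by apply: logn_coprime.
rewrite EK add0n addnC addnA => /addIn E.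
by rewrite dvdzE abszX pfactor_dvdn // E leq_addl.
Qed.

Theorem theorem3p1 (p k q : nat) (b : nat -> int)
    (p_prime : prime p) (k_gt0 : (0 < k)%N) (q_def : q = (p ^ k)%N)
    (b0 : (b 0%N = 1 %[mod q%:Z])%Z)
    (b1 : forall x : nat, (q%:Z ^+ 2 %| fdiff b x)%Z)
    (bn : forall n x : nat, (2 <= n)%N -> (q%:Z ^+ n %| iter n fdiff b x)%Z) :
  forall n : nat,
    let xi := logn p (qcatalan q n) in
    xi%:R = ((digit_sum p (q.-1 * n).+1)%:R - 1) / (p%:R - 1) :> rat
    /\ (wqcatalan b q n = (qcatalan q n)%:Z %[mod p%:Z ^+ (xi + k)])%Z.
Proof.
move=> n xi; have p_gt1 := prime_gt1 p_prime.
have Hxi : (xi + logn p ((q.-1 * n).+1)`! = n * logn p q`!)%N.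
  by rewrite /xi q_def; apply: logn_qcatalan.
split.
  have EL := legendre (q.-1 * n).+1 p_prime.
  have Eq := logn_fact_exp k p_prime; rewrite -q_def in Eq.
  (* Multiply [Hxi] by [p-1]: with [L = (q-1)n+1], the right side becomes [n(q-1) = L-1], and
     Legendre gives [L - s_p(L)] for the factorial. *)
  have E : (p.-1 * xi + 1 = digit_sum p (q.-1 * n).+1)%N.
    have := congr1 (muln p.-1) Hxi; rewrite mulnDr mulnCA Eq [(n * _)%N]mulnC.
    by lia.
  have p1 : p%:R - 1 != 0 :> rat by rewrite subr_eq0 (eqr_nat _ p 1); lia.
  rewrite -E natrD addrK natrM -subn1 natrB; last exact: ltnW.
  by rewrite mulrAC divff ?mul1r.
have q_gt1 : (1 < q)%N by rewrite q_def -(exp1n k) ltn_exp2r.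
apply/eqP; rewrite eqz_mod_dvd; clearbody xi.
case: q q_def b0 b1 bn Hxi q_gt1 => // m q_def b0 b1 bn Hxi m_gt0.
set q := m.+1 in q_def b0 b1 bn Hxi *.
(* The coefficients have denominator [q!^n], and the congruence modulo [q] divides once more by [q].
   By [Hxi] the valuation of [K] exceeds that of [((q-1)n+1)!] by exactly [xi + k]. *)
pose K := (q * q`! ^ n)%N.
have K_gt0 : (0 < K)%N by rewrite muln_gt0 expn_gt0 fact_gt0.
apply: (@dvdz_of_local_int p _ K ((q.-1 * n).+1)`!) => //.
  exact: fact_gt0.
  rewrite /K lognM ?expn_gt0 ?fact_gt0 // lognX -Hxi.
  by rewrite {1}q_def pfactorK //; lia.
have Hb j x : (q%:Z ^+ j %| iter j fdiff b x)%Z.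
  case: j => [|[|j]]; [exact: dvd1z | | exact: bn].
  by apply: dvdz_trans (b1 x); rewrite dvdz_exp2l.
have {}b0 : (q %| b 0%N - 1)%Z by rewrite -eqz_mod_dvd; apply/eqP.
have Ew c := coef_tree_poly c n (m_gt0 : (1 < q)%N).
(* The coefficient of degree [mn+1] requires truncation order [mn+2], which height [n] allows
   because [m > 0]. *)
have leN : ((m * n).+2 <= (m * n.+1).+1)%N by rewrite mulnS; lia.
have := tree_poly_congr p m_gt0 leN b0 (b1 0%N) Hb (ltnSn _).
rewrite coefZ coefB !Ew -mulrBl -rmorphB wqcatalan1 //.
by congr (local_int _ _); rewrite /K natrM natrX invfM; ring.
Qed.
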